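(* Suppose the standing assumptions (1)–(5) below hold. Let the updated dataset be $\mathcal{D}'=(\mathbf{Z}',\mathbf{y})$, which differs from $\mathcal{D}=(\mathbf{Z},\mathbf{y})$ only in the embedding of the $n$-th training graph: $\mathbf{z}_i'=\mathbf{z}_i$ for $i<n$ and $\mathbf{z}_n'=\Phi(\mathbf{S}_n,\mathbf{x}_n')$, where $\mathbf{x}_n'\in\mathbb{R}^{g_n}$ agrees with $\mathbf{x}_n$ except that $[\mathbf{x}_n']_{g_n}=0$ (feature removal of the $g_n$-th node). Let $B$ be the upper frame constant of the graph wavelets used in the GST. Then the updated model $\mathbf{w}'=\mathbf{w}^\star+\mathbf{H}_{\mathbf{w}^\star}^{-1}\Delta$ satisfies $$\|\nabla L(\mathbf{w}',\mathcal{D}')\|\leq \frac{\gamma_2 F^3}{\lambda^2 n}\min\left\{4C_1^2,\ \frac{(\gamma_1 C_1 F^2+\lambda C_2 F)^2}{\lambda^2 g_n}\right\},\qquad F=\sqrt{\sum_{l=0}^{L-1}B^{2l}}.$$ In particular, for tight energy-preserving wavelets one has $B=1$ and $F=\sqrt{L}$.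
   Context: Setting (graph classification). There are $n$ training graphs $\mathcal{G}_1,\dots,\mathcal{G}_n$. Graph $\mathcal{G}_i$ has $g_i$ nodes, a symmetric adjacency matrix $\mathbf{S}_i\in\mathbb{R}^{g_i\times g_i}$ (the graph shift operator), a node signal $\mathbf{x}_i\in\mathbb{R}^{g_i}$ (one scalar feature per node) and a label $y_i$. Graph scattering transform (GST). Fix positive integers $J,L$ and wavelet kernel functions $h_1,\dots,h_J:\mathbb{R}\to\mathbb{R}$. For a symmetric $\mathbf{S}=\mathbf{V}\mathbf{\Lambda}\mathbf{V}^T$ with eigenvalues $\lambda_1,\dots,\lambda_g$, set $\mathbf{H}_j(\mathbf{S})=\mathbf{V}\,\mathrm{diag}(h_j(\lambda_1),\dots,h_j(\lambda_g))\mathbf{V}^T$. The wavelets form a frame: there are constants $0<A\le B$ with $A^2\|\mathbf{x}\|^2\le\sum_{j=1}^J\|\mathbf{H}_j(\mathbf{S})\mathbf{x}\|^2\le B^2\|\mathbf{x}\|^2$ for all $\mathbf{x}$. Let $\rho$ be the entrywise absolute value. For a path $p=(j_1,\dots,j_l)$ with $j_k\in\{1,\dots,J\}$ and $0\le l\le L-1$, define $\Phi_{()}(\mathbf{S},\mathbf{x})=\mathbf{x}$ and $\Phi_{(j_1,\dots,j_l)}(\mathbf{S},\mathbf{x})=\rho\big(\mathbf{H}_{j_l}(\mathbf{S})\Phi_{(j_1,\dots,j_{l-1})}(\mathbf{S},\mathbf{x})\big)$, and the scalar coefficient $\phi_p(\mathbf{S},\mathbf{x})=U\Phi_p(\mathbf{S},\mathbf{x})$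 with the averaging operator $U=\frac{1}{g}\mathbf{1}^T$ ($g$ the number of nodes). The embedding $\Phi(\mathbf{S},\mathbf{x})\in\mathbb{R}^d$, $d=\sum_{l=0}^{L-1}J^l$, is the concatenation of all $\phi_p(\mathbf{S},\mathbf{x})$. Set $\mathbf{z}_i=\Phi(\mathbf{S}_i,\mathbf{x}_i)$, let $\mathbf{Z}$ have rows $\mathbf{z}_i^T$, and $\mathcal{D}=(\mathbf{Z},\mathbf{y})$. Learning and update. $\ell(s,y)$ is convex and twice differentiable in $s$; $\ell'$, $\ell''$ denote derivatives in $s$, and $\nabla$, $\nabla^2$ denote gradient/Hessian in $\mathbf{w}$. For a dataset $\mathcal{D}=(\mathbf{Z},\mathbf{y})$, $L(\mathbf{w},\mathcal{D})=\sum_{i=1}^n\big(\ell(\mathbf{w}^T\mathbf{z}_i,y_i)+\frac{\lambda}{2}\|\mathbf{w}\|^2\big)$ with $\lambda>0$, and $\mathbf{w}^\star=\arg\min_{\mathbf{w}}L(\mathbf{w},\mathcal{D})$. For the updated dataset $\mathcal{D}'$, set $\mathbf{H}_{\mathbf{w}^\star}=\nabla^2L(\mathbf{w}^\star,\mathcal{D}')$ and $\Delta=\nabla L(\mathbf{w}^\star,\mathcal{D})-\nabla L(\mathbf{w}^\star,\mathcal{D}')$. Norms are $\ell_2$ for vectors and operator norm for matrices. Standing assumptions: there are constants $C_1,C_2,\gamma_1,\gamma_2$ such that for every embedding $\mathbf{z}_i$ (of $\mathcal{D}$ or $\mathcal{D}'$) and every $\mathbf{w}\in\mathbb{R}^d$: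 (1) $\|\nabla\ell(\mathbf{w}^T\mathbf{z}_i,y_i)\|\le C_1$; (2) $|\ell'(\mathbf{w}^T\mathbf{z}_i,y_i)|\le C_2$; (3) $\ell'$ is $\gamma_1$-Lipschitz; (4) $\ell''$ is $\gamma_2$-Lipschitz; (5) the signals satisfy $|[\mathbf{x}_i]_j|\le1$ for all $i$ and all $j\in\{1,\dots,g_i\}$. *)

(* Defs.v *)
From HB Require Import structures.
From mathcomp Require Import all_boot all_order all_algebra.
From mathcomp Require Import all_classical all_reals all_analysis.
Set Implicit Arguments. Unset Strict Implicit. Unset Printing Implicit Defensive.
Import Order.TTheory GRing.Theory Num.Theory.
Import numFieldNormedType.Exports.
Local Open Scope ring_scope.

Section GST.
Variable R : realType.

Definition l2 (a b : nat) (M : 'M[R]_(a, b)) : R :=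
  Num.sqrt (\sum_(i < a) \sum_(j < b) M i j ^+ 2).

Definition dotr (d : nat) (u v : 'rV[R]_d) : R := \sum_(k < d) u 0 k * v 0 k.

(* Spectral filter H_j(S) = V diag(h(lambda_1..lambda_g)) V^T, given the
   eigendecomposition S = V diag(lambda) V^T. *)
Definition spec_filter (g : nat) (V : 'M[R]_g) (lam : 'I_g -> R) (h : R -> R)
  : 'M[R]_g := V *m diag_mx (\row_k h (lam k)) *m V^T.

(* Scattering paths (j_1,...,j_l) with 0 <= l <= L-1, j_k in {1..J}
   (indexed from 0 here). *)
Definition GPath (J L : nat) := {l : 'I_L & l.-tuple 'I_J}.

Definition Phi_path (J g : nat) (H : 'I_J -> 'M[R]_g) (x : 'cV[R]_g)
  (p : seq 'I_J) : 'cV[R]_g :=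
  foldl (fun v j => map_mx (fun a => `|a|) (H j *m v)) x p.

Definition phi_path (J g : nat) (H : 'I_J -> 'M[R]_g) (x : 'cV[R]_g)
  (p : seq 'I_J) : R :=
  (g%:R)^-1 * \sum_(k < g) Phi_path H x p k 0.

(* The GST embedding: concatenation of all phi_p, in the fixed order given by
   the enumeration of the finite type of paths; its dimension is
   #|GPath J L| = sum_{l<L} J^l = d. *)
Definition gst (J L g : nat) (H : 'I_J -> 'M[R]_g) (x : 'cV[R]_g)
  : 'rV[R]_#|{: GPath J L}| :=
  \row_k phi_path H x (tval (projT2 (enum_val k))).

Definition gradient (d : nat) (f : 'rV[R]_d -> R) (w : 'rV[R]_d) : 'rV[R]_d :=
  \row_k ('D_(delta_mx 0 k) f w).

Definition hessian (d : nat) (f : 'rV[R]_d -> R) (w : 'rV[R]_d) : 'M[R]_d :=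
  \matrix_(k, m) ('D_(delta_mx 0 m) (fun u => 'D_(delta_mx 0 k) f u) w).

Definition dloss (Y : Type) (l : R -> Y -> R) (y : Y) : R -> R :=
  derive1 (fun s => l s y).
Definition ddloss (Y : Type) (l : R -> Y -> R) (y : Y) : R -> R :=
  derive1 (dloss l y).

Definition Loss (Y : Type) (n d : nat) (l : R -> Y -> R) (lambda : R)
  (Z : 'I_n -> 'rV[R]_d) (y : 'I_n -> Y) (w : 'rV[R]_d) : R :=
  \sum_(i < n) (l (dotr w (Z i)) (y i) + lambda / 2 * l2 w ^+ 2).

End GST.

(* Main.v *)
(** The gradient of [L(., D)] vanishes at [w*], so [Delta] is minus the gradient of
    [L(., D')] at [w*] and [w'] is one Newton step for [L(., D')].  With
    [s_i = <w*, z_i'>] and [t_i = <w' - w*, z_i'>], the gradient after the step is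
    the sum of the Taylor remainders
    [(l'(s_i + t_i) - l'(s_i) - l''(s_i) t_i) z_i'], each of norm at most
    [gamma2 |w' - w*|^2 F^3], while strong convexity gives
    [n lambda |w' - w*| <= |Delta|].  It remains to bound
    [Delta = l'(<w*, z_n>) z_n - l'(<w*, z_n'>) z_n']: trivially by [2 C1], and, as
    [|w*| <= C1 / lambda], by [(C2 + gamma1 (C1 / lambda) F) |z_n - z_n'|].  The
    frame bound makes the coefficients of order [l] of the scattering transform
    [B^l]-Lipschitz, and the averaging operator contributes a factor [1 / sqrt g_n],
    so [|z_n - z_n'| <= F / sqrt g_n]. *)
Require Import Defs.
From HB Require Import structures.
From mathcomp Require Import all_boot all_order all_algebra.
From mathcomp Require Import all_classical all_reals all_analysis.
From mathcomp Require Import ring lra.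
Import Order.TTheory GRing.Theory Num.Theory.
Import numFieldNormedType.Exports.
Local Open Scope ring_scope.

(** * Euclidean norm and inner product *)

(** Lagrange's identity: twice the gap between the two sides is the sum over all pairs [(i, j)] of
    [(a i * b j - a j * b i) ^+ 2]. *)
Lemma cauchy_schwarz_sum (R : realType) (I : finType) (a b : I -> R) :
  (\sum_i a i * b i) ^+ 2 <= (\sum_i a i ^+ 2) * (\sum_i b i ^+ 2).
Proof.
rewrite -(ler_pM2l (ltr0n R 2)) [leRHS]mulr_natl mulr2n expr2 !big_distrlr /=.
rewrite [X in _ <= _ + X]exchange_big -big_split /= mulr_sumr.
apply: ler_sum => i _; rewrite -big_split mulr_sumr; apply: ler_sum => j _ /=.
by have := sqr_ge0 (a i * b j - a j * b i); nra.
Qed.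

Lemma l2_ge0 (R : realType) (a b : nat) (M : 'M[R]_(a, b)) : 0 <= l2 M.
Proof. exact: sqrtr_ge0. Qed.

Lemma l2_sqr (R : realType) (a b : nat) (M : 'M[R]_(a, b)) :
  l2 M ^+ 2 = \sum_i \sum_j M i j ^+ 2.
Proof.
rewrite sqr_sqrtr // sumr_ge0 // => i _.
by rewrite sumr_ge0 // => j _; rewrite sqr_ge0.
Qed.

Lemma ler_sum_mul_l2 (R : realType) (a b : nat) (M N : 'M[R]_(a, b)) :
  \sum_i \sum_j M i j * N i j <= l2 M * l2 N.
Proof.
apply: le_trans (ler_norm _) _.
rewrite -ler_sqr ?nnegrE ?mulr_ge0 ?l2_ge0 // exprMn !l2_sqr real_normK ?num_real //.
by rewrite !pair_bigA /=; exact: (cauchy_schwarz_sum _ _ (fun p => M p.1 p.2)).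
Qed.

Lemma l2D (R : realType) (a b : nat) (M N : 'M[R]_(a, b)) :
  l2 (M + N) <= l2 M + l2 N.
Proof.
rewrite -ler_sqr ?nnegrE ?addr_ge0 ?l2_ge0 // sqrrD !l2_sqr.
have -> : \sum_i \sum_j (M + N) i j ^+ 2 = \sum_i \sum_j M i j ^+ 2
    + (\sum_i \sum_j M i j * N i j) *+ 2 + \sum_i \sum_j N i j ^+ 2.
  rewrite -sumrMnl -!big_split; apply: eq_bigr => i _ /=.
  by rewrite -sumrMnl -!big_split; apply: eq_bigr => j _ /=; rewrite mxE sqrrD.
by rewrite lerD2r lerD2l lerMn2r ler_sum_mul_l2 orbT.
Qed.

Lemma l2Z (R : realType) (a b : nat) (c : R) (M : 'M[R]_(a, b)) :
  l2 (c *: M) = `|c| * l2 M.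
Proof.
rewrite /l2 -sqrtr_sqr -sqrtrM ?sqr_ge0 // mulr_sumr; congr Num.sqrt.
by apply: eq_bigr => i _; rewrite mulr_sumr; apply: eq_bigr => j _; rewrite mxE exprMn.
Qed.

Lemma l20 (R : realType) (a b : nat) : l2 (0 : 'M[R]_(a, b)) = 0.
Proof. by rewrite -(scale0r (0 : 'M[R]_(a, b))) l2Z normr0 mul0r. Qed.

Lemma l2N (R : realType) (a b : nat) (M : 'M[R]_(a, b)) : l2 (- M) = l2 M.
Proof. by rewrite -scaleN1r l2Z normrN1 mul1r. Qed.

Lemma l2_sum (R : realType) (a b : nat) (I : finType) (M : I -> 'M[R]_(a, b)) :
  l2 (\sum_i M i) <= \sum_i l2 (M i).
Proof.
elim/big_ind2: _ => [|M1 c1 M2 c2 h1 h2|//]; first by rewrite l20.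
exact: le_trans (l2D _ _ _ _ _) (lerD h1 h2).
Qed.

Lemma dotr_l2 (R : realType) (d : nat) (u : 'rV[R]_d) : dotr u u = l2 u ^+ 2.
Proof. by rewrite l2_sqr big_ord1; apply: eq_bigr => k _; rewrite expr2. Qed.

Lemma ler_dotr_l2 (R : realType) (d : nat) (u v : 'rV[R]_d) : dotr u v <= l2 u * l2 v.
Proof. by have := ler_sum_mul_l2 _ _ _ u v; rewrite big_ord1. Qed.

Lemma dotrDl (R : realType) (d : nat) (u v z : 'rV[R]_d) :
  dotr (u + v) z = dotr u z + dotr v z.
Proof. by rewrite -big_split; apply: eq_bigr => k _; rewrite mxE mulrDl. Qed.

Lemma dotrZl (R : realType) (d : nat) (c : R) (u z : 'rV[R]_d) :
  dotr (c *: u) z = c * dotr u z.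
Proof. by rewrite mulr_sumr; apply: eq_bigr => k _; rewrite mxE mulrA. Qed.

Lemma dotrC (R : realType) (d : nat) (u z : 'rV[R]_d) : dotr u z = dotr z u.
Proof. by apply: eq_bigr => k _; rewrite mulrC. Qed.

Lemma dotr_suml (R : realType) (d : nat) (I : finType) (u : I -> 'rV[R]_d) (z : 'rV[R]_d) :
  dotr (\sum_i u i) z = \sum_i dotr (u i) z.
Proof.
by rewrite /dotr exchange_big; apply: eq_bigr => k _; rewrite summxE mulr_suml.
Qed.

Lemma dotr_delta (R : realType) (d : nat) (k : 'I_d) (z : 'rV[R]_d) :
  dotr (delta_mx 0 k) z = z 0 k.
Proof.
rewrite /dotr (bigD1 k) //= mxE !eqxx mul1r big1 ?addr0 // => j jk.
by rewrite mxE (negbTE jk) andbF mul0r.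
Qed.

Lemma norm_dotr_l2 (R : realType) (d : nat) (u v : 'rV[R]_d) :
  `|dotr u v| <= l2 u * l2 v.
Proof.
rewrite ler_norml ler_dotr_l2 andbT lerNl -mulN1r -dotrZl scaleN1r.
by rewrite -(l2N _ _ _ u) ler_dotr_l2.
Qed.

(** * Lipschitz and norm bounds for the scattering transform *)

(** Splits the paths of length [l.+1] by their first wavelet, for the induction on path length. *)
Lemma big_tuple_cons (R : realType) (T : finType) (l : nat) (F : l.+1.-tuple T -> R) :
  \sum_p F p = \sum_j \sum_(p : l.-tuple T) F [tuple of j :: p].
Proof.
rewrite pair_bigA /= (reindex (fun q : T * l.-tuple T => [tuple of q.1 :: q.2])) //=.
exists (fun p : l.+1.-tuple T => (thead p, [tuple of behead p])) => [[j p]|p] _ /=.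
  by rewrite theadE; congr pair; apply: val_inj.
by rewrite [RHS]tuple_eta; apply: val_inj.
Qed.

Lemma l2_absB (R : realType) (a b : nat) (M N : 'M[R]_(a, b)) :
  l2 (map_mx (fun t => `|t|) M - map_mx (fun t => `|t|) N) <= l2 (M - N).
Proof.
rewrite ler_wsqrtr //; apply: ler_sum => i _; apply: ler_sum => j _.
rewrite !mxE -real_normK ?num_real // -[leRHS]real_normK ?num_real //.
by rewrite ler_sqr ?nnegrE // ler_dist_dist.
Qed.

Lemma Phi_path0 (R : realType) (J g : nat) (H : 'I_J -> 'M[R]_g) (p : seq 'I_J) :
  Phi_path H 0 p = 0.
Proof.
elim: p => //= j p; rewrite mulmx0 (_ : map_mx _ _ = 0) //.
by apply/matrixP => i k; rewrite !mxE normr0.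
Qed.

(** Induction on [l] with both signals generalized: after the first wavelet [j], the rest of the
    path starts from [|H j x|] and [|H j x'|]. The absolute value does not expand distances, so
    summing over [j] and using the frame bound costs one factor [B ^+ 2]. *)
Lemma Phi_path_lip (R : realType) (J g : nat) (H : 'I_J -> 'M[R]_g) (B : R) :
  (forall z, \sum_j l2 (H j *m z : 'cV_g) ^+ 2 <= B ^+ 2 * l2 z ^+ 2) ->
  forall l (x x' : 'cV[R]_g),
  \sum_(p : l.-tuple 'I_J) l2 (Phi_path H x p - Phi_path H x' p) ^+ 2
    <= B ^+ (2 * l) * l2 (x - x') ^+ 2.
Proof.
move=> frame; elim=> [|l IH] x x'.
  rewrite muln0 expr0 mul1r (bigD1 [tuple]) //= big1 ?addr0 // => p.
  by case/eqP; apply: tuple0.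
rewrite big_tuple_cons /=.
apply: le_trans (ler_sum _ (fun j _ => IH _ _)) _.
rewrite -mulr_sumr mulnS exprD mulrC mulrAC ler_wpM2r ?exprn_even_ge0 ?oddM //.
apply: le_trans (frame _); apply: ler_sum => j _.
by rewrite ler_sqr ?nnegrE ?l2_ge0 // mulmxBr l2_absB.
Qed.

(** Cauchy-Schwarz against the all-ones vector; this is the source of the factor [1 / g]. *)
Lemma sqr_avg_le (R : realType) (g : nat) (u : 'cV[R]_g) :
  (g%:R^-1 * \sum_k u k 0) ^+ 2 <= g%:R^-1 * l2 u ^+ 2.
Proof.
(* For [g = 0] both sides vanish, because the inverse of [0] is [0]. *)
have [->|g0] := eqVneq g%:R (0 : R); first by rewrite invr0 !mul0r expr0n.
have gp : 0 < g%:R :> R by rewrite lt_def g0 ler0n.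
have := cauchy_schwarz_sum _ _ (fun k => u k 0) (fun=> 1).
rewrite sumr_const cardT size_enum_ord expr1n.
under eq_bigr do rewrite mulr1.
have -> : \sum_k u k 0 ^+ 2 = l2 u ^+ 2.
  by rewrite l2_sqr; apply: eq_bigr => k _; rewrite big_ord1.
move=> h; rewrite exprMn expr2 -mulrA ler_pM2l ?invr_gt0 //.
by rewrite mulrC ler_pdivrMr.
Qed.

Lemma gst_lip (R : realType) (J L g : nat) (H : 'I_J -> 'M[R]_g) (B : R)
    (x x' : 'cV[R]_g) :
  (forall z, \sum_j l2 (H j *m z : 'cV_g) ^+ 2 <= B ^+ 2 * l2 z ^+ 2) ->
  l2 (gst L H x - gst L H x') ^+ 2
    <= (\sum_(l < L) B ^+ (2 * l)) * (g%:R^-1 * l2 (x - x') ^+ 2).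
Proof.
move=> frame.
pose G (p : GPath J L) :=
  g%:R^-1 * l2 (Phi_path H x (projT2 p) - Phi_path H x' (projT2 p)) ^+ 2.
apply: (@le_trans _ _ (\sum_(p : GPath J L) G p)).
  have -> : \sum_p G p = \sum_(k < #|{: GPath J L}|) G (enum_val k).
    by rewrite -big_enum_val; apply: eq_bigl => p; rewrite inE.
  rewrite l2_sqr big_ord1.
  apply: ler_sum => k _; rewrite !mxE /phi_path -mulrBr -sumrB.
  by apply: le_trans (sqr_avg_le _ _ _); under [in leRHS]eq_bigr do rewrite !mxE.
(* Paths are dependent pairs (length, tuple); grouping them by length allows [Phi_path_lip] to be
   applied for each [l]. *)
have -> : \sum_p G p = \sum_(l < L) \sum_(p : l.-tuple 'I_J) G (existT _ l p).
  by rewrite (sig_big_dep predT (fun _ => predT)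
      (fun (l : 'I_L) (p : l.-tuple 'I_J) => G (existT _ l p))) /=;
    apply: eq_bigr => -[].
rewrite mulr_suml.
apply: ler_sum => l _; rewrite -mulr_sumr mulrCA ler_wpM2l ?invr_ge0 //.
exact: Phi_path_lip.
Qed.

(** The Lipschitz bound against the zero signal, whose embedding is zero. A signal with entries
    bounded by [1] has squared norm at most [g], which cancels the [1 / g] of the averaging. *)
Lemma gst_norm_le (R : realType) (J L g : nat) (H : 'I_J -> 'M[R]_g) (B : R)
    (x : 'cV[R]_g) :
  (forall z, \sum_j l2 (H j *m z : 'cV_g) ^+ 2 <= B ^+ 2 * l2 z ^+ 2) ->
  (forall k, `|x k 0| <= 1) ->
  l2 (gst L H x) <= Num.sqrt (\sum_(l < L) B ^+ (2 * l)).
Proof.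
move=> frame x1.
have B0 : 0 <= \sum_(l < L) B ^+ (2 * l).
  by apply: sumr_ge0 => l _; rewrite exprM exprn_ge0 // sqr_ge0.
rewrite -ler_sqr ?nnegrE ?l2_ge0 ?sqrtr_ge0 // [leRHS]sqr_sqrtr //.
have gst0 : gst L H 0 = 0.
  apply/rowP => k; rewrite !mxE /phi_path big1 ?mulr0 // => i _.
  by rewrite Phi_path0 mxE.
rewrite -[gst L H x]subr0 -gst0; apply: le_trans (gst_lip _ _ _ _ _ _ _ _ frame) _.
rewrite subr0.
rewrite ler_piMr //.
have xg : l2 x ^+ 2 <= g%:R.
  rewrite l2_sqr -[g in leRHS]card_ord -sumr_const; apply: ler_sum => k _.
  by rewrite big_ord1 -real_normK ?num_real // expr_le1.
have [->|g0] := eqVneq (g%:R : R) 0; first by rewrite invr0 mul0r ler01.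
by rewrite ler_pdivrMl ?mulr1 // lt_def g0 ler0n.
Qed.

(** * One-variable calculus: derivatives along lines, convexity, Taylor remainder *)

Lemma derive_along (R : realType) (d : nat) (f : 'rV[R]_d -> R) (w e : 'rV[R]_d) (df : R) :
  is_derive (0 : R) (1 : R) (fun t : R => f (t *: e + w)) df -> 'D_e f w = df.
Proof.
move=> [_ <-]; rewrite -[RHS]derive1E /derive1 /derive scale0r add0r.
by under [in RHS]eq_fun do rewrite addr0.
Qed.

Lemma derivable_is_derive1 (R : realType) (f : R -> R) (s : R) :
  derivable f s 1 -> is_derive s 1 f (derive1 f s).
Proof. by move=> h; rewrite derive1E; apply: DeriveDef. Qed.

Lemma is_derive_comp_affine (R : realType) (f : R -> R) (a b t df : R) :
  is_derive (t * a + b) 1 f df -> is_derive t 1 (fun u => f (u * a + b)) (df * a).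
Proof.
move=> h; apply: (@is_derive1_comp _ f (fun u => u * a + b)) => //.
by apply: is_derive_eq; rewrite addr0 scaler0 add0r [LHS]mulr1.
Qed.

(** The graph lies above its tangents; adding the tangent inequalities at [a] and at [b] gives
    [(f' b - f' a) * (b - a) >= 0]. *)
Lemma convex_derivative_ndecr (R : realType) (f : R -> R) :
  (forall s, derivable f s 1) ->
  (forall a b t, 0 <= t <= 1 -> f (t * a + (1 - t) * b) <= t * f a + (1 - t) * f b) ->
  {homo derive1 f : a b / a <= b}.
Proof.
move=> df cvx.
have tangent a b : derive1 f a * (b - a) <= f b - f a.
  have D : is_derive (0 : R) (1 : R) (fun t => f (t * (b - a) + a)) (derive1 f a * (b - a)).
    by apply: is_derive_comp_affine; rewrite mul0r add0r; apply: derivable_is_derive1.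
  (* Only the right limit is used: for [0 < t <= 1] convexity bounds each difference quotient by
     [f b - f a]. *)
  case: D => /cvg_dnbhs_at_right D <-.
  apply: (cvgr_to_le D).
  near=> t.
  have t0 : 0 < t by near: t; apply: nbhs_right_gt.
  have t1 : t <= 1 by near: t; apply: nbhs_right_le.
  rewrite /= addr0 [t *: 1]mulr1 mul0r add0r /GRing.scale /= ler_pdivrMl //.
  have := cvx b a t; rewrite (ltW t0) t1 => /(_ isT).
  by rewrite (_ : t * b + (1 - t) * a = t * (b - a) + a); [lra | ring].
move=> a b; rewrite le_eqVlt => /predU1P[->//|ab].
have := tangent a b; have := tangent b a; nra.
Unshelve. all: by end_near.
Qed.

Lemma derive1_ndecr_ge0 (R : realType) (f : R -> R) (s : R) :
  derivable f s 1 -> {homo f : a b / a <= b} -> 0 <= derive1 f s.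
Proof.
move=> df hf; rewrite derive1E; apply: limr_ge => //.
near=> t.
have t0 : t != 0 by near: t; apply: nbhs_dnbhs_neq.
rewrite /= [t *: 1]mulr1 /GRing.scale /=.
case: (ltgtP t 0) t0 => // t0 _.
  by rewrite mulr_le0 ?invr_le0 ?(ltW t0) // subr_le0 hf // gerDr ltW.
by rewrite mulr_ge0 ?invr_ge0 ?(ltW t0) // subr_ge0 hf // lerDr ltW.
Unshelve. all: by end_near.
Qed.

(** The mean value theorem turns the increment into [f' r * t] with [r] within [|t|] of [s]. This
    gives the constant [c], where integration would give [c / 2]. *)
Lemma taylor1_lip (R : realType) (f : R -> R) (c s t : R) :
  (forall s, derivable f s 1) ->
  (forall s t, `|derive1 f s - derive1 f t| <= c * `|s - t|) ->
  `|f (s + t) - f s - derive1 f s * t| <= c * t ^+ 2.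
Proof.
move=> df lip.
have D (r : R) : is_derive r (1 : R) f (derive1 f r) by apply: derivable_is_derive1.
have C : continuous f by move=> r; apply: differentiable_continuous; apply/derivable1_diffP.
have c0 : 0 <= c by have := lip 1 0; rewrite subr0 normr1 mulr1; apply: le_trans.
have K a b : a <= b -> exists2 r, a <= r <= b & f b - f a = derive1 f r * (b - a).
  move=> ab; have [//|r] := MVT_segment ab (fun r _ => D r).
    by apply: continuous_subspaceT.
  by rewrite in_itv => ? ?; exists r.
have [r rs ->] : exists2 r, `|r - s| <= `|t| & f (s + t) - f s = derive1 f r * t.
  have [t0|t0] := leP 0 t.
    have [|r /andP[sr rt] E] := K s (s + t); first by rewrite lerDl.
    exists r; last by rewrite E addrAC subrr add0r.
    by rewrite (ger0_norm t0) ger0_norm ?subr_ge0 // lerBlDl.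
  have [|r /andP[sr rt] E] := K (s + t) s; first by rewrite gerDl ltW.
  exists r; last by rewrite -opprB E opprD addNKr mulrN opprK.
  by rewrite (ltr0_norm t0) ler0_norm ?subr_le0 //; lra.
rewrite -mulrBl normrM -real_normK ?num_real // expr2 mulrA ler_wpM2r //.
by apply: le_trans (lip _ _) _; rewrite ler_wpM2l.
Qed.

(** * Gradient, Hessian and Newton step of the regularized loss *)

Section RegularizedLoss.
Variables (R : realType) (Y : Type) (n d : nat) (loss : R -> Y -> R) (lambda : R).
Variables (Z : 'I_n -> 'rV[R]_d) (y : 'I_n -> Y).
Hypothesis loss_derivable : forall yy s, derivable (fun t => loss t yy) s 1.
Hypothesis dloss_derivable : forall yy s, derivable (dloss loss yy) s 1.

Lemma gradient_loss_dotr (yy : Y) (z w : 'rV[R]_d) :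
  gradient (fun u => loss (dotr u z) yy) w = dloss loss yy (dotr w z) *: z.
Proof.
apply/rowP => k; rewrite !mxE; apply: derive_along.
rewrite (_ : (fun t => _) = (fun t => loss (t * z 0 k + dotr w z) yy)); last first.
  by apply/funext => t; rewrite dotrDl dotrZl (dotr_delta _ _ k z).
apply: (@is_derive_comp_affine _ (fun s => loss s yy)).
by rewrite mul0r add0r; apply: derivable_is_derive1.
Qed.

(** At [t = 0] this yields the gradient. Arbitrary [t] provides the derivability on an open interval
    required by the criterion for a minimum. *)
Lemma is_derive_Loss_line (e w : 'rV[R]_d) (t : R) :
  is_derive t (1 : R) (fun t => Loss loss lambda Z y (t *: e + w))
    (\sum_i (dloss loss (y i) (dotr (t *: e + w) (Z i)) * dotr e (Z i)
             + lambda * dotr (t *: e + w) e)).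
Proof.
rewrite (_ : (fun t => _) = \sum_i (fun t => loss (t * dotr e (Z i) + dotr w (Z i)) (y i)
   + lambda / 2 * (t * (t * dotr e e) + t * (2 * dotr w e) + dotr w w))); last first.
  apply/funext => u; rewrite fct_sumE; apply: eq_bigr => i _.
  rewrite dotrDl dotrZl -dotr_l2 dotrDl dotrZl !(dotrC _ _ _ (_ + _)) !dotrDl !dotrZl.
  by rewrite (dotrC _ _ e w); congr (_ + _ * _); ring.
apply: is_derive_sum => i; apply: is_deriveD.
  apply: (@is_derive_comp_affine _ (fun s => loss s (y i))).
  by rewrite dotrDl dotrZl; apply: derivable_is_derive1.
apply: is_derive_eq; rewrite dotrDl dotrZl /GRing.scale /=.
by field.
Qed.

Lemma gradient_LossE (w : 'rV[R]_d) :
  gradient (Loss loss lambda Z y) w =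
  \sum_i (dloss loss (y i) (dotr w (Z i)) *: Z i + lambda *: w).
Proof.
apply/rowP => k; rewrite !mxE; apply: derive_along.
apply: (is_derive_eq (is_derive_Loss_line _ _ _)).
rewrite scale0r add0r summxE; apply: eq_bigr => i _.
by rewrite dotr_delta (dotrC _ _ w (delta_mx _ _)) dotr_delta !mxE.
Qed.

Lemma gradient_Loss_min (w : 'rV[R]_d) :
  (forall u, Loss loss lambda Z y w <= Loss loss lambda Z y u) ->
  gradient (Loss loss lambda Z y) w = 0.
Proof.
move=> wmin; apply/rowP => k; rewrite !mxE; apply: derive_along.
apply: (@derive1_at_min _ _ (-1) 1) => [|t _||t _].
- by lra.
- by have [] := is_derive_Loss_line (delta_mx 0 k) w t.
- by rewrite in_itv /=; apply/andP; split; lra.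
- by rewrite scale0r add0r wmin.
Qed.

(** The Hessian is the sum of the rank-one matrices [l'' z^T z] plus [lambda] times the identity,
    once per sample. Its action on row vectors is the form used for coercivity, symmetry and the
    Newton equation. *)
Lemma mulmx_hessian_Loss (w v : 'rV[R]_d) :
  v *m hessian (Loss loss lambda Z y) w =
  \sum_i ((ddloss loss (y i) (dotr w (Z i)) * dotr v (Z i)) *: Z i + lambda *: v).
Proof.
have E : hessian (Loss loss lambda Z y) w = \sum_i
    (ddloss loss (y i) (dotr w (Z i)) *: ((Z i)^T *m Z i) + lambda *: 1%:M).
  apply/matrixP => k m; rewrite !mxE; apply: derive_along.
  rewrite (_ : (fun t => _) = \sum_i (fun t =>
      Z i 0 k * dloss loss (y i) (t * Z i 0 m + dotr w (Z i))
      + lambda * (t * (m == k)%:R + w 0 k))); last first.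
    apply/funext => t; have := gradient_LossE (t *: delta_mx 0 m + w).
    move=> /rowP/(_ k); rewrite mxE => ->; rewrite fct_sumE summxE.
    apply: eq_bigr => i _; rewrite dotrDl dotrZl dotr_delta !mxE eqxx /=.
    by rewrite (eq_sym k m) [in LHS](mulrC _ (Z i 0 k)).
  rewrite summxE; apply: is_derive_sum => i; rewrite !mxE big_ord1 !mxE.
  have ? : is_derive (0 : R) (1 : R)
      (fun t : R => dloss loss (y i) (t * Z i 0 m + dotr w (Z i)))
      (ddloss loss (y i) (dotr w (Z i)) * Z i 0 m).
    apply: is_derive_comp_affine; rewrite mul0r add0r.
    exact: derivable_is_derive1.
  apply: is_derive_eq; rewrite /GRing.scale /= (eq_sym k m).
  by ring.
rewrite E mulmx_sumr; apply: eq_bigr => i _.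
rewrite mulmxDr -!scalemxAr mulmx1 mulmxA (mx11_scalar (v *m _)) mul_scalar_mx scalerA.
by congr (_ * _ *: _ + _); rewrite mxE; apply: eq_bigr => k _; rewrite mxE.
Qed.

Hypothesis dloss_ndecr : forall yy, {homo dloss loss yy : a b / a <= b}.
Hypothesis lambda_gt0 : 0 < lambda.

(** Each sample contributes [l'' * (dotr v z) ^+ 2], nonnegative since [l'] is nondecreasing, and
    [lambda * l2 v ^+ 2]. *)
Lemma hessian_Loss_coercive (w v : 'rV[R]_d) :
  n%:R * lambda * l2 v ^+ 2 <= dotr (v *m hessian (Loss loss lambda Z y) w) v.
Proof.
rewrite mulmx_hessian_Loss dotr_suml -mulrA mulr_natl -[in leLHS](card_ord n) -sumr_const.
apply: ler_sum => i _; rewrite dotrDl !dotrZl dotr_l2 lerDr (dotrC _ _ (Z i)) -mulrA.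
by rewrite mulr_ge0 // -?expr2 ?sqr_ge0 // derive1_ndecr_ge0.
Qed.

Lemma hessian_Loss_unit (w : 'rV[R]_d) :
  (0 < n)%N -> hessian (Loss loss lambda Z y) w \in unitmx.
Proof.
move=> n0; rewrite -row_free_unit -kermx_eq0; apply/rowV0P => v /sub_kermxP vH.
have := hessian_Loss_coercive w v; rewrite vH [dotr 0 v]big1; last first.
  by move=> k _; rewrite mxE mul0r.
rewrite pmulr_rle0 ?mulr_gt0 ?ltr0n // => v0.
have {v0} : l2 v ^+ 2 == 0 by rewrite eq_le v0 sqr_ge0.
rewrite l2_sqr big_ord1 psumr_eq0 => [/allP v0|k _]; last exact: sqr_ge0.
apply/rowP => k; have := v0 k; rewrite mem_index_enum => /(_ isT).
by rewrite sqrf_eq0 mxE => /eqP.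
Qed.

(** Quadratic estimate for a Newton step from any point [w]; it is later applied to the updated
    embeddings at [wstar]. *)
Lemma newton_step_residual (gamma F : R) (w : 'rV[R]_d) :
  (0 < n)%N ->
  (forall i s t, `|ddloss loss (y i) s - ddloss loss (y i) t| <= gamma * `|s - t|) ->
  (forall i, l2 (Z i) <= F) ->
  let f := Loss loss lambda Z y in
  l2 (gradient f (w + (invmx (hessian f w) *m (- gradient f w)^T)^T)) <=
    gamma * F ^+ 3 / (lambda ^+ 2 * n%:R) * l2 (gradient f w) ^+ 2.
Proof.
move=> n0 lip ZF; cbv zeta; set f := Loss _ _ _ _; set H := hessian f w; set dw := (_ *m _)^T.
have Hunit : H \in unitmx by apply: hessian_Loss_unit.
(* The step is defined through a column vector; symmetry turns it into the row equation
   [dw *m H = - gradient f w]. *)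
have Hsym : H^T = H.
  apply/matrixP => k m; rewrite mxE.
  have entry a b : H a b = (delta_mx 0 a *m H : 'rV_d) 0 b.
    by rewrite -rowE [RHS]mxE.
  rewrite !entry /H !mulmx_hessian_Loss !summxE; apply: eq_bigr => i _.
  by rewrite !mxE !dotr_delta eqxx /= (eq_sym k m); ring.
have dwH : dw *m H = - gradient f w.
  by rewrite -[in LHS]Hsym -trmx_mul mulmxA mulmxV // mul1mx trmxK.
have n0R : 0 < n%:R :> R by rewrite ltr0n.
have nl0 : 0 < n%:R * lambda by rewrite mulr_gt0.
(* Coercivity and Cauchy-Schwarz, then division by [l2 dw]; hence the separate case of a zero
   step. *)
have dw_le : n%:R * lambda * l2 dw <= l2 (gradient f w).
  have [->|dw0] := eqVneq (l2 dw) 0; first by rewrite mulr0 l2_ge0.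
  have dwp : 0 < l2 dw by rewrite lt_def dw0 l2_ge0.
  rewrite -(ler_pM2r dwp) -[leLHS]mulrA -[X in _ * X <= _]expr2.
  apply: le_trans (hessian_Loss_coercive w dw) _.
  by rewrite -/f -/H dwH; apply: le_trans (ler_dotr_l2 _ _ _ _) _; rewrite l2N.
have F0 : 0 <= F by apply: le_trans (l2_ge0 _ _ _ _) (ZF (Ordinal n0)).
have g0 : 0 <= gamma.
  by have := lip (Ordinal n0) 1 0; rewrite subr0 normr1 mulr1; apply: le_trans.
have -> : gradient f (w + dw) = \sum_i
    (dloss loss (y i) (dotr w (Z i) + dotr dw (Z i)) - dloss loss (y i) (dotr w (Z i))
     - ddloss loss (y i) (dotr w (Z i)) * dotr dw (Z i)) *: Z i.
  (* Subtracts zero written as [gradient f w + dw *m H]; the regularizer is linear in the gradient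
     and cancels exactly. *)
  rewrite -[LHS]subr0 -[X in _ - X](subrr (gradient f w)) -dwH opprD addrA.
  rewrite !gradient_LossE /H mulmx_hessian_Loss -!sumrB; apply: eq_bigr => i _.
  rewrite dotrDl !scalerBl scalerDr.
  by apply/rowP => k; rewrite !mxE; ring.
apply: le_trans (l2_sum _ _ _ _ _) _.
apply: (@le_trans _ _ (\sum_(i < n) gamma * F ^+ 3 * l2 dw ^+ 2)).
  apply: ler_sum => i _; rewrite l2Z.
  rewrite (_ : gamma * _ * _ = gamma * (l2 dw * F) ^+ 2 * F); last by ring.
  apply: ler_pM => //; first exact: l2_ge0.
  apply: le_trans (taylor1_lip _ _ _ _ _ _ _) _; [by []|exact: lip|].
  rewrite ler_wpM2l // -[leLHS]real_normK ?num_real // ler_sqr ?nnegrE ?mulr_ge0 ?l2_ge0 //.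
  by apply: le_trans (norm_dotr_l2 _ _ _ _) _; rewrite ler_wpM2l ?l2_ge0.
rewrite sumr_const card_ord -[leLHS]mulr_natl mulrCA -[leRHS]mulrA.
rewrite ler_wpM2l ?mulr_ge0 ?exprn_ge0 //.
rewrite ler_pdivlMl ?mulr_gt0 ?exprn_gt0 //.
rewrite [leLHS](_ : _ = (n%:R * lambda * l2 dw) ^+ 2); last by ring.
by rewrite ler_sqr ?nnegrE ?l2_ge0 // mulr_ge0 ?l2_ge0 // ltW.
Qed.
End RegularizedLoss.

(** * Effect of the feature removal on the gradient, and the final estimate *)

Theorem theorem4p2 (R : realType)
  (* graphs *)
  (n : nat) (g : 'I_n -> nat)
  (S : forall i : 'I_n, 'M[R]_(g i))
  (V : forall i : 'I_n, 'M[R]_(g i)) (lam : forall i : 'I_n, 'I_(g i) -> R)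
  (x : forall i : 'I_n, 'cV[R]_(g i))
  (Y : Type) (y : 'I_n -> Y)
  (* GST parameters *)
  (J L : nat) (h : 'I_J -> R -> R) (A B : R)
  (* learning *)
  (loss : R -> Y -> R) (lambda C1 C2 gamma1 gamma2 : R)
  (wstar : 'rV[R]_#|{: GPath J L}|)
  (* the modified graph (the n-th one) and the removed node (the g_n-th) *)
  (m : 'I_n) (v : 'I_(g m)) :
  (0 < J)%N -> (0 < L)%N ->
  (* eigendecomposition S_i = V_i diag(lambda_i) V_i^T, V_i orthogonal *)
  (forall i, (V i)^T *m V i = 1%:M) ->
  (forall i, S i = V i *m diag_mx (\row_k lam i k) *m (V i)^T) ->
  (* frame property of the wavelets on every graph *)
  0 < A -> A <= B ->
  (forall i (z : 'cV[R]_(g i)),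
      A ^+ 2 * l2 z ^+ 2 <= \sum_(j < J) l2 (spec_filter (V i) (lam i) (h j) *m z) ^+ 2
   /\ \sum_(j < J) l2 (spec_filter (V i) (lam i) (h j) *m z) ^+ 2 <= B ^+ 2 * l2 z ^+ 2) ->
  (* the loss: twice differentiable and convex in s *)
  (forall yy s, derivable (fun t => loss t yy) s 1) ->
  (forall yy s, derivable (dloss loss yy) s 1) ->
  (forall yy a b t, 0 <= t <= 1 ->
      loss (t * a + (1 - t) * b) yy <= t * loss a yy + (1 - t) * loss b yy) ->
  0 < lambda ->
  (m : nat) = n.-1 -> (v : nat) = (g m).-1 ->
  let H i j := spec_filter (V i) (lam i) (h j) in
  let Z i := gst L (H i) (x i) in
  let xm' := \col_k (if k == v then 0 else x m k 0) in
  let Z' i := if i == m then gst L (H m) xm' else Z i in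
  let LD := Loss loss lambda Z y in
  let LD' := Loss loss lambda Z' y in
  (* standing assumptions (1)-(5) *)
  (forall i w, l2 (gradient (fun u => loss (dotr u (Z i)) (y i)) w) <= C1) ->
  (forall w, l2 (gradient (fun u => loss (dotr u (Z' m)) (y m)) w) <= C1) ->
  (forall i w, `|dloss loss (y i) (dotr w (Z i))| <= C2) ->
  (forall w, `|dloss loss (y m) (dotr w (Z' m))| <= C2) ->
  (forall i s t, `|dloss loss (y i) s - dloss loss (y i) t| <= gamma1 * `|s - t|) ->
  (forall i s t, `|ddloss loss (y i) s - ddloss loss (y i) t| <= gamma2 * `|s - t|) ->
  (forall i k, `|x i k 0| <= 1) ->
  (* w* minimizes L(., D) *)
  (forall w, LD wstar <= LD w) ->
  let Hw := hessian LD' wstar in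
  let Delta := gradient LD wstar - gradient LD' wstar in
  let w' := wstar + (invmx Hw *m Delta^T)^T in
  let F := Num.sqrt (\sum_(l < L) B ^+ (2 * l)) in
  l2 (gradient LD' w') <=
    gamma2 * F ^+ 3 / (lambda ^+ 2 * n%:R) *
    Num.min (4 * C1 ^+ 2)
            ((gamma1 * C1 * F ^+ 2 + lambda * C2 * F) ^+ 2 / (lambda ^+ 2 * (g m)%:R)).
Proof.
move=> J0 L0 Vorth SE A0 AB frame dl ddl cvx lambda0 mn vg H Z xm' Z' LD LD'.
move=> hC1 hC1' hC2 hC2' lip1 lip2 x1 wmin; cbv zeta.
set F := Num.sqrt _.
have hB i (z : 'cV_(g i)) : \sum_j l2 (H i j *m z) ^+ 2 <= B ^+ 2 * l2 z ^+ 2.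
  by have [_] := frame i z.
have n0 : (0 < n)%N by apply: leq_ltn_trans (ltn_ord m).
have n0R : 0 < n%:R :> R by rewrite ltr0n.
have g0 : 0 < (g m)%:R :> R by rewrite ltr0n; apply: leq_ltn_trans (ltn_ord v).
have F0 : 0 <= F by apply: sqrtr_ge0.
have FF : F ^+ 2 = \sum_(l < L) B ^+ (2 * l).
  by rewrite sqr_sqrtr // sumr_ge0 // => l _; rewrite exprM exprn_ge0 // sqr_ge0.
have xm'1 k : `|xm' k 0| <= 1 by rewrite mxE; case: eqP => // _; rewrite normr0.
have Zm' : Z' m = gst L (H m) xm' by rewrite /Z' eqxx.
have ZF i : l2 (Z i) <= F by apply: gst_norm_le.
have Z'F i : l2 (Z' i) <= F by rewrite /Z'; case: eqP => // _; apply: gst_norm_le.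
have ndecr yy : {homo dloss loss yy : a b / a <= b}.
  by apply: convex_derivative_ndecr => // a b t; apply: cvx.
have G0 : gradient LD wstar = 0 by apply: gradient_Loss_min.
(* Stationarity says that [n * lambda * wstar] is minus a sum of [n] loss gradients, each of norm at
   most [C1]. *)
have wC1 : l2 wstar <= C1 / lambda.
  rewrite ler_pdivlMr // mulrC -[X in X * _](ger0_norm (ltW lambda0)) -l2Z.
  rewrite -(ler_pM2l n0R) -[X in X * l2 _](ger0_norm (ler0n R n)) -l2Z.
  move: G0; rewrite gradient_LossE // big_split /= sumr_const card_ord -scaler_nat.
  move=> /(canRL (addrK _)); rewrite sub0r => E.
  rewrite -l2N -E; apply: le_trans (l2_sum _ _ _ _ _) _.
  rewrite mulr_natl -[in leRHS](card_ord n) -sumr_const; apply: ler_sum => i _.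
  by have := hC1 i wstar; rewrite gradient_loss_dotr.
have E : gradient LD wstar - gradient LD' wstar =
    dloss loss (y m) (dotr wstar (Z m)) *: Z m
    - dloss loss (y m) (dotr wstar (Z' m)) *: Z' m.
  rewrite !gradient_LossE // -sumrB (bigD1 m) //= big1 ?addr0 => [|i im].
    by rewrite opprD addrACA subrr addr0.
  by rewrite /Z' (negbTE im) subrr.
have C20 : 0 <= C2 by apply: le_trans (hC2 m 0).
have g10 : 0 <= gamma1.
  by have := lip1 m 1 0; rewrite subr0 normr1 mulr1; apply: le_trans.
have g20 : 0 <= gamma2.
  by have := lip2 m 1 0; rewrite subr0 normr1 mulr1; apply: le_trans.
have C10 : 0 <= C1 by apply: le_trans (l2_ge0 _ _ _ _) (hC1 m 0).
have ZZ' : l2 (Z m - Z' m) <= F / Num.sqrt (g m)%:R.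
  rewrite -ler_sqr ?nnegrE ?l2_ge0 ?divr_ge0 ?sqrtr_ge0 // Zm'.
  apply: le_trans (gst_lip _ _ _ _ _ _ _ _ (hB m)) _.
  rewrite exprMn exprVn FF (sqr_sqrtr (ler0n R (g m))).
  rewrite ler_wpM2l -?FF ?exprn_ge0 // ler_piMr ?invr_ge0 ?ler0n //.
  (* The two signals differ only at node [v], by an entry of absolute value at most [1]. *)
  rewrite l2_sqr (bigD1 v) //= [X in _ + X]big1 ?addr0 => [|k kv].
    by rewrite big_ord1 !mxE eqxx subr0 -real_normK ?num_real // expr_le1.
  by rewrite big_ord1 !mxE (negbTE kv) subrr expr0n.
have D1 : l2 (gradient LD wstar - gradient LD' wstar) <= 2 * C1.
  rewrite E; apply: le_trans (l2D _ _ _ _ _) _; rewrite l2N mulr_natl mulr2n.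
  apply: lerD; first by have := hC1 m wstar; rewrite gradient_loss_dotr.
  by have := hC1' wstar; rewrite gradient_loss_dotr.
have D2 : l2 (gradient LD wstar - gradient LD' wstar) <=
    (gamma1 * C1 * F ^+ 2 + lambda * C2 * F) / (lambda * Num.sqrt (g m)%:R).
  have -> : (gamma1 * C1 * F ^+ 2 + lambda * C2 * F) / (lambda * Num.sqrt (g m)%:R)
    = C2 * (F / Num.sqrt (g m)%:R)
      + gamma1 * (C1 / lambda * (F / Num.sqrt (g m)%:R)) * F.
    by field; rewrite !gt_eqF ?sqrtr_gt0.
  (* Separates the change of the embedding from the change of the slope [l']. *)
  have -> : gradient LD wstar - gradient LD' wstar =
      dloss loss (y m) (dotr wstar (Z m)) *: (Z m - Z' m)
      + (dloss loss (y m) (dotr wstar (Z m)) - dloss loss (y m) (dotr wstar (Z' m))) *: Z' m.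
    by rewrite E scalerBr scalerBl addrA subrK.
  apply: le_trans (l2D _ _ _ _ _) _; rewrite !l2Z; apply: lerD.
    by apply: ler_pM => //; exact: l2_ge0.
  apply: ler_pM => //; first exact: l2_ge0.
  apply: le_trans (lip1 _ _ _) _; rewrite ler_wpM2l //.
  rewrite dotrC (dotrC _ _ _ (Z' m)) -mulN1r -dotrZl -dotrDl scaleN1r dotrC.
  apply: le_trans (norm_dotr_l2 _ _ _ _) _.
  by apply: ler_pM => //; exact: l2_ge0.
(* With the first gradient zero, [Delta] is minus the gradient of [LD'], as in
   [newton_step_residual]. *)
rewrite {1}G0 sub0r.
apply: le_trans (newton_step_residual _ _ _ _ _ _ _ _ dl ddl ndecr lambda0 gamma2 F _ n0 _ Z'F) _.
  by move=> i; apply: lip2.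
rewrite -/LD' ler_wpM2l ?divr_ge0 ?mulr_ge0 ?exprn_ge0 ?(ltW lambda0) //.
have -> : l2 (gradient LD' wstar) = l2 (gradient LD wstar - gradient LD' wstar).
  by rewrite G0 sub0r l2N.
rewrite le_min; apply/andP; split.
  rewrite (_ : 4 * C1 ^+ 2 = (2 * C1) ^+ 2); last by ring.
  by rewrite ler_sqr ?nnegrE ?l2_ge0 ?mulr_ge0.
(* Writing [g m] as a squared root makes the second entry of the minimum the square of the bound in
   [D2]. *)
rewrite -[(g m)%:R]sqr_sqrtr ?ler0n // -exprMn -expr_div_n.
by rewrite ler_sqr ?nnegrE ?l2_ge0 //; apply: le_trans D2; exact: l2_ge0.
Qed.
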